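(* Let $(P,C)$ be a Hidden Markov Model, i.e. $P\in\mathbb{R}^{n\times n}$ and $C\in\mathbb{R}^{m\times n}$ are column-stochastic, and let $\mathcal{S}\subset\mathcal{D}(\mathbb{R}^n)$ be a finite set of probability vectors. Let $\mathcal{R}=\mathrm{span}\{P^t p_0 \mid t\ge 0,\ p_0\in\mathcal{S}\}$ and $\mathcal{N}=\{x\in\mathbb{R}^n \mid CP^t x=0 \text{ for all } 0\le t\le n-1\}$. Let $\mathcal{E}$ be any linear subspace with $(\mathcal{R}\cap\mathcal{N})\oplus\mathcal{E}=\mathcal{R}$ and let $p\in\mathbb{R}^n$ be any vector with $p_i>0$ for all $i$. Define $\mathscr{A}$ as follows: first put $\mathscr{A}_0=\mathrm{alg}(p^{-1}\wedge\mathcal{E})$; if $\mathbb{E}^T_{|\mathscr{A}_0,p}(\mathcal{R}\cap\mathcal{N})\subseteq\mathcal{R}\cap\mathcal{N}$ then $\mathscr{A}=\mathscr{A}_0$, and otherwise $\mathscr{A}=\mathrm{alg}(p^{-1}\wedge\mathcal{R})$. Let $d=\dim\mathscr{A}$, let $J\in\mathbb{R}^{n\times d}$ and $R\in\mathbb{R}^{d\times n}$ be the factors of $\mathbb{E}^T_{|\mathscr{A},p}=JR$ given in the context, and set $\check P=RPJ$, $\check C=CJ$. Then $d\le n$, and: (i) $\check P\in\mathbb{R}^{d\times d}$ and $\check C\in\mathbb{R}^{m\times d}$ are column-stochastic (so $(\check P,\check C)$ is a Hidden Markov Model), and $Rp_0\in\mathcal{D}(\mathbb{R}^d)$ for every $p_0\in\mathcal{S}$;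 (ii) $(\check P,\check C)$ with initial condition $Rp_0$ has the same single-time output marginals as $(P,C)$ with initial condition $p_0$, i.e. $CP^tp_0=\check C\check P^t R p_0$ for all $t\ge 0$ and all $p_0\in\mathcal{S}$.
   Context: A matrix is column-stochastic if its entries are nonnegative and each column sums to 1. $\mathcal{D}(\mathbb{R}^k)$ denotes the set of probability vectors in $\mathbb{R}^k$ (nonnegative entries summing to 1). For a Hidden Markov Model $(P,C)$ with initial distribution $p_0$, the distribution of the output at time $t$ is $CP^tp_0$. $\wedge$ is the entrywise product on $\mathbb{R}^n$; for a vector $p$ with no zero entries, $p^{-1}$ is the entrywise inverse, and $p^{-1}\wedge\mathcal{X}=\{p^{-1}\wedge x\mid x\in\mathcal{X}\}$. A subalgebra of $\mathbb{R}^n$ is a linear subspace closed under $\wedge$ (not necessarily containing the all-ones vector $\mathbf{1}$). $\mathrm{alg}(\mathcal{X})$ is the smallest subalgebra of $\mathbb{R}^n$ containing $\mathcal{X}$. Every subalgebra $\mathscr{A}$ of dimension $d$ has a unique (up to order) basis $a_1,\dots,a_d$ consisting of $0/1$ vectors with pairwise disjoint supports. With this basis and the standard basis $e_1,\dots,e_d$ of $\mathbb{R}^d$, and the standard inner product $\langle\cdot,\cdot\rangle$, define $$\mathbb{E}^T_{|\mathscr{A},p}=\sum_{j=1}^d\frac{(p\wedge a_j)a_j^T}{\langle p,a_j\rangle},\qquad J=\sum_{j=1}^d\frac{(p\wedge a_j)e_j^T}{\langle p,a_j\rangle},\qquad R=\sum_{j=1}^d e_ja_j^T .$$ *)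

(* Defs.v *)
From HB Require Import structures.
From mathcomp Require Import all_boot all_order all_algebra.
From mathcomp Require Import boolp classical_sets functions cardinality reals.

Set Implicit Arguments.
Unset Strict Implicit.
Unset Printing Implicit Defensive.

Import Order.TTheory GRing.Theory Num.Theory.
Local Open Scope ring_scope.
Local Open Scope classical_set_scope.

Section Stochastic.
Variable R : realType.

Definition col_stochastic m n (M : 'M[R]_(m, n)) : Prop :=
  (forall i j, 0 <= M i j) /\ (forall j, \sum_i M i j = 1).

Definition prob_vec k (x : 'cV[R]_k) : Prop :=
  (forall i, 0 <= x i 0) /\ \sum_i x i 0 = 1.

Definition is_HMM m n (P : 'M[R]_n) (C : 'M[R]_(m, n)) : Prop :=
  col_stochastic P /\ col_stochastic C.

End Stochastic.

Section SmallestSubspace.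
Variables (K : fieldType) (vT : vectType K).

Definition is_smallest (Q : set {vspace vT}) : set {vspace vT} :=
  [set U | Q U /\ forall W : {vspace vT}, Q W -> (U <= W)%VS].

(* The default value 0 is never used below, see [smallest_vspaceP]. *)
Definition smallest_vspace (Q : set {vspace vT}) : {vspace vT} :=
  xget 0%VS (is_smallest Q).

Lemma smallest_vspaceP (Q : set {vspace vT}) :
  (exists U, Q U) -> (forall U W, Q U -> Q W -> Q (U :&: W)%VS) ->
  is_smallest Q (smallest_vspace Q).
Proof.
move=> [U0 QU0] QI; apply: xgetPex.
have ex_dim : exists k, `[< exists2 U, Q U & \dim U = k >].
  by exists (\dim U0); apply/asboolP; exists U0.
case: (ex_minnP ex_dim) => k /asboolP[U QU dimU] min_k.
exists U; split=> // W QW; apply/capv_idPl/eqP.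
rewrite eqEdim capvSl /= dimU; apply: min_k; apply/asboolP.
by exists (U :&: W)%VS => //; apply: QI.
Qed.

(* Unlike the library's [span], the generating set may be infinite. *)
Definition vspan (X : set vT) : {vspace vT} :=
  smallest_vspace [set U | X `<=` [set` U]].

Lemma vspanP (X : set vT) : is_smallest [set U | X `<=` [set` U]] (vspan X).
Proof.
apply: smallest_vspaceP => [|U W XU XW x Xx].
  by exists fullv => x _ /=; rewrite memvf.
by apply/memv_capP; split; [apply: XU | apply: XW].
Qed.

End SmallestSubspace.

Section Subalgebras.
Variables (R : realType) (n : nat).
Implicit Types (x y p : 'cV[R]_n) (A : {vspace 'cV[R]_n}).

Definition hmul x y : 'cV[R]_n := map2_mx *%R x y.
Definition hinv x : 'cV[R]_n := map_mx GRing.inv x.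
Definition inner x y : R := \sum_i x i 0 * y i 0.

(* Not required to contain the all-ones vector. *)
Definition is_subalg A : Prop :=
  forall x y, x \in A -> y \in A -> hmul x y \in A.

Definition alg (X : set 'cV[R]_n) : {vspace 'cV[R]_n} :=
  smallest_vspace [set A | is_subalg A /\ X `<=` [set` A]].

Lemma algP (X : set 'cV[R]_n) :
  is_smallest [set A | is_subalg A /\ X `<=` [set` A]] (alg X).
Proof.
apply: smallest_vspaceP => [|U W [algU XU] [algW XW]].
  by exists fullv; split=> [x y _ _ | x _ /=]; rewrite memvf.
split=> [x y | x Xx].
  rewrite !memv_cap => /andP[xU xW] /andP[yU yW].
  by rewrite algU // algW.
by apply/memv_capP; split; [apply: XU | apply: XW].
Qed.

Definition canonical_basis A (a : (\dim A).-tuple 'cV[R]_n) : Prop :=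
  [/\ basis_of A a,
      forall j i, tnth a j i 0 = 0 \/ tnth a j i 0 = 1
    & forall j k, j != k -> hmul (tnth a j) (tnth a k) = 0].

Section Factors.
Variables (p : 'cV[R]_n) (d : nat) (a : d.-tuple 'cV[R]_n).

Definition cond_exp_mx : 'M[R]_n :=
  \sum_(j < d) (inner p (tnth a j))^-1 *:
    (hmul p (tnth a j) *m (tnth a j)^T).

(* [delta_mx 0 j] and [delta_mx j 0] are the row e_j^T and the column e_j. *)
Definition J_mx : 'M[R]_(n, d) :=
  \sum_(j < d) (inner p (tnth a j))^-1 *:
    (hmul p (tnth a j) *m (delta_mx 0 j : 'rV[R]_d)).

Definition R_mx : 'M[R]_(d, n) :=
  \sum_(j < d) (delta_mx j 0 : 'cV[R]_d) *m (tnth a j)^T.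

End Factors.

(* The canonical basis of a subalgebra is unique up to order, which does not
   affect [cond_exp]; the default value is never used for a subalgebra, see
   [canonical_basis_exists]. *)
Definition some_canonical_basis A : (\dim A).-tuple 'cV[R]_n :=
  xget (vbasis A) (@canonical_basis A).

Definition cond_exp A p : 'M[R]_n := cond_exp_mx p (some_canonical_basis A).

End Subalgebras.

Section CanonicalBasis.
Variables (R : realType) (n : nat) (A : {vspace 'cV[R]_n}).
Hypothesis algA : is_subalg A.

Let nz (i : 'I_n) : bool := `[< exists2 x, x \in A & x i 0 != 0 >].
Let eqv (i j : 'I_n) : bool := `[< forall x, x \in A -> x i 0 = x j 0 >].
Let atom (i : 'I_n) : 'cV[R]_n := \col_j (eqv i j)%:R.

Let hmulE (x y : 'cV[R]_n) i : hmul x y i 0 = x i 0 * y i 0.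
Proof. by rewrite mxE. Qed.

Let separate i j : nz i -> ~~ eqv i j ->
  exists y, [/\ y \in A, y i 0 = 1 & y j 0 = 0].
Proof.
move=> /asboolP[z zA zi] /asboolPn.
have scale y : y \in A -> y i 0 != 0 -> y j 0 = 0 ->
    exists y, [/\ y \in A, y i 0 = 1 & y j 0 = 0].
  move=> yA yi yj; exists ((y i 0)^-1 *: y).
  by rewrite rpredZ // !mxE mulVf // yj mulr0.
have case1 x : x \in A -> x i 0 != 0 -> x i 0 != x j 0 ->
    exists y, [/\ y \in A, y i 0 = 1 & y j 0 = 0].
  move=> xA xi xij; apply: (scale (hmul x x - x j 0 *: x)).
  - by rewrite rpredB ?rpredZ // algA.
  - by rewrite !mxE -mulrBl mulf_neq0 // subr_eq0.
  - by rewrite !mxE subrr.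
move=> /existsNP[x /not_implyP[xA /eqP xij]].
have [xi0|xi] := eqVneq (x i 0) 0; last exact: case1 xij.
have [zij|zij] := eqVneq (z i 0) (z j 0); last exact: case1 zij.
have xj : x j 0 != 0 by rewrite -xi0 eq_sym.
apply: (scale (z - (z j 0 / x j 0) *: x)).
- by rewrite rpredB // rpredZ.
- by rewrite !mxE xi0 mulr0 subr0.
- by rewrite !mxE divfK // subrr.
Qed.

Let atom_in i : nz i -> atom i \in A.
Proof.
move=> nzi.
have sep (s : seq 'I_n) : exists y, [/\ y \in A, y i 0 = 1
    & forall j, j \in s -> ~~ eqv i j -> y j 0 = 0].
  elim: s => [|j s [y [yA yi ys]]].
    have /asboolP[z zA zi] := nzi.
    by exists ((z i 0)^-1 *: z); rewrite rpredZ // !mxE mulVf.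
  have [eij|neij] := boolP (eqv i j).
    exists y; split=> // k; rewrite inE => /predU1P[-> | /ys//].
    by rewrite eij.
  have [w [wA wi wj]] := separate nzi neij.
  exists (hmul y w); split; first exact: algA.
    by rewrite hmulE yi wi mulr1.
  move=> k; rewrite hmulE inE => /predU1P[-> _|ks nk].
    by rewrite wj mulr0.
  by rewrite (ys k) // mul0r.
have [y [yA yi y0]] := sep (enum 'I_n).
suff -> : atom i = y by [].
apply/colP => j; rewrite mxE.
have [eij|neij] := boolP (eqv i j); last by rewrite y0 // mem_enum.
by move/asboolP: eij => /(_ y yA) <-; rewrite yi.
Qed.

Let eqv_refl i : eqv i i. Proof. exact/asboolP. Qed.

Let atom_eqv i j : eqv i j -> atom i = atom j.
Proof.
move=> /asboolP eij; apply/colP => k; rewrite !mxE; congr (_%:R : R).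
by congr (nat_of_bool _); apply/asboolP/asboolP => e x xA;
  rewrite -(e x xA) (eij x xA).
Qed.

Let atom_cap i j k : atom i k 0 != 0 -> atom j k 0 != 0 -> atom i = atom j.
Proof.
rewrite !mxE !pnatr_eq0 !eqb0 !negbK => eik ejk.
by rewrite (atom_eqv eik) (atom_eqv ejk).
Qed.

Lemma canonical_basis_exists : exists a, @canonical_basis R n A a.
Proof.
pose s := undup [seq atom i | i <- enum 'I_n & nz i].
have s_atom x : x \in s -> exists2 i, nz i & x = atom i.
  by rewrite mem_undup => /mapP[i]; rewrite mem_filter => /andP[? _] ->; exists i.
have atom_s i : nz i -> atom i \in s.
  by move=> nzi; rewrite mem_undup map_f // mem_filter nzi mem_enum.
pose b := in_tuple s.
have b_atom j : exists2 i, nz i & tnth b j = atom i by apply/s_atom/mem_tnth.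
have b_inj : injective (tnth b) by apply/tuple_uniqP/undup_uniq.
have b_disj j k i : j != k -> tnth b j i 0 != 0 -> tnth b k i 0 = 0.
  move=> jk bj; apply/eqP/negPn/negP => bk; case/negP: jk; apply/eqP/b_inj.
  have [i1 _ e1] := b_atom j; have [i2 _ e2] := b_atom k.
  by rewrite e1 e2 in bj bk *; apply: atom_cap bj bk.
have free_s : free s.
  apply/(freeP (X := b)) => c sum0 j.
  have [i nzi bj] := b_atom j.
  have bji : tnth b j i 0 = 1 by rewrite bj mxE eqv_refl.
  have := congr1 (fun x : 'cV_n => x i 0) sum0.
  have nthE (k : 'I_(size s)) : b`_k = tnth b k by rewrite (tnth_nth 0).
  rewrite summxE [RHS]mxE (bigD1 j) //= mxE nthE bji mulr1.
  rewrite big1 ?addr0 // => k kj; rewrite mxE nthE (b_disj j k) ?mulr0 //.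
    by rewrite eq_sym.
  by rewrite bji oner_eq0.
have span_s : <<s>>%VS = A.
  apply/eqP; rewrite eqEsubv; apply/andP; split.
    by apply/span_subvP => x /s_atom[i nzi ->]; apply: atom_in.
  apply/subvP => x xA.
  have [f fP] := choice (fun j => let: ex_intro2 i _ e := b_atom j in
                                  ex_intro (fun i => tnth b j = atom i) i e).
  suff -> : x = \sum_j x (f j) 0 *: tnth b j.
    by apply: rpred_sum => j _; rewrite rpredZ // memv_span // mem_tnth.
  apply/colP => k; rewrite summxE.
  have term j : tnth b j k 0 != 0 -> x (f j) 0 = x k 0.
    rewrite fP mxE pnatr_eq0 eqb0 negbK => /asboolP; exact.
  have [nzk|/asboolPn nnzk] := boolP (nz k).
    have /tnthP[j0 bj0] : atom k \in b by apply: atom_s.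
    have bj0k : tnth b j0 k 0 = 1 by rewrite -bj0 mxE eqv_refl.
    rewrite (bigD1 j0) //= mxE bj0k mulr1 term ?bj0k ?oner_eq0 //.
    rewrite big1 ?addr0 // => j jj0; rewrite mxE (b_disj j0 j) ?mulr0 //.
      by rewrite eq_sym.
    by rewrite bj0k oner_eq0.
  have xk : x k 0 = 0.
    by apply/eqP/negPn/negP => xk; apply: nnzk; exists x.
  rewrite xk big1 // => j _; rewrite mxE.
  have [->|/term ->] := eqVneq (tnth b j k 0) 0; first by rewrite mulr0.
  by rewrite xk mul0r.
have bs : basis_of A s by rewrite basisEdim span_s subvv -span_s (eqP free_s) /=.
have size_s : size s == \dim A by rewrite -span_s (eqP free_s).
exists (Tuple size_s); split=> // [j i | j k jk].
  have /s_atom[i0 _ ->] : tnth (Tuple size_s) j \in s by apply: mem_tnth.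
  by rewrite mxE; case: (eqv _ _); [right | left].
pose c := cast_ord (esym (eqP size_s)).
have tE l : tnth (Tuple size_s) l = tnth b (c l).
  by rewrite !(tnth_nth 0).
apply/colP => i; rewrite !tE hmulE mxE.
have [->|nz0] := eqVneq (tnth b (c j) i 0) 0; first by rewrite mul0r.
by rewrite (b_disj (c j) (c k)) ?mulr0 // (inj_eq (@cast_ord_inj _ _ _)).
Qed.

End CanonicalBasis.

Section Reduction.
Variables (R : realType) (m n : nat).
Variables (P : 'M[R]_n) (C : 'M[R]_(m, n)) (S : set 'cV[R]_n).

Definition reach : {vspace 'cV[R]_n} :=
  vspan [set x | exists t p0, S p0 /\ x = P ^+ t *m p0].

Definition unobs : {vspace 'cV[R]_n} :=
  (\bigcap_(t < n) lker (linfun (mulmx (C *m P ^+ t))))%VS.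

Lemma mem_unobs (x : 'cV[R]_n) :
  x \in unobs <-> forall t, (t < n)%N -> C *m P ^+ t *m x = 0.
Proof.
rewrite memvE; split=> [/subv_bigcapP xN t tn | xN].
  by have := xN (Ordinal tn) isT; rewrite -memvE memv_ker lfunE => /eqP.
apply/subv_bigcapP => t _; rewrite -memvE memv_ker lfunE /=.
by rewrite xN.
Qed.

Definition reach_unobs : {vspace 'cV[R]_n} := (reach :&: unobs)%VS.

Definition alg_scaled (p : 'cV[R]_n) (X : {vspace 'cV[R]_n}) :
    {vspace 'cV[R]_n} :=
  alg [set hmul (hinv p) x | x in [set` X]].

Definition reduced_alg (E : {vspace 'cV[R]_n}) (p : 'cV[R]_n) :
    {vspace 'cV[R]_n} :=
  let A0 := alg_scaled p E in
  if (linfun (mulmx (cond_exp A0 p)) @: reach_unobs <= reach_unobs)%VS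
  then A0 else alg_scaled p reach.

End Reduction.

(* Main.v *)
Require Import Defs.
From HB Require Import structures.
From mathcomp Require Import all_boot all_order all_algebra.
From mathcomp Require Import boolp classical_sets functions cardinality reals.

Set Implicit Arguments.
Unset Strict Implicit.
Unset Printing Implicit Defensive.

Import Order.TTheory GRing.Theory Num.Theory.
Local Open Scope ring_scope.
Local Open Scope classical_set_scope.

(* Let Pi = J R be the conditional expectation onto A, Z = R /\ N and chi the
   indicator of the support of A. Pi fixes p /\ A, so in either branch of the
   definition of A, Pi x - x lies in Z for every reachable x; as Z is P-stable
   (Cayley-Hamilton) and killed by C, an induction modulo Z yields (ii).
   A need not contain the all-ones vector, so the column sums in (i) require
   that P preserve the support of A. The column sums of Pi are chi, and vectors
   of Z sum to 0, hence chi^T x = 1^T x on reachable x; each P^t p_0 is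
   nonnegative and is therefore supported in supp A. Conversely every index of
   supp A is charged by some P^t p_0, so its image under P stays in supp A. *)

(** The coefficients are those of the remainder of X^t modulo the characteristic polynomial, by
    Cayley-Hamilton. *)
Lemma expmx_sum_lt (K : fieldType) n (P : 'M[K]_n) t :
  exists c : 'I_n -> K, P ^+ t = \sum_(i < n) c i *: P ^+ i.
Proof.
case: n P => [|n] P; first by exists (fun=> 0); apply/matrixP => -[].
pose q := 'X^t %% char_poly P.
have q_size : (size q <= n.+1)%N.
  by rewrite -ltnS -(size_char_poly P) ltn_modp monic_neq0 ?char_poly_monic.
exists (fun i => (poly_rV q : 'rV_n.+1) 0 i).
have -> : P ^+ t = horner_mx P q.
  rewrite -[P in LHS]horner_mx_X -rmorphXn /= [in LHS](divp_eq 'X^t (char_poly P)).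
  by rewrite rmorphD rmorphM /= Cayley_Hamilton mulr0 add0r.
rewrite -[q in LHS](poly_rV_K q_size) horner_rVpoly mulmx_sum_row linear_sum /=.
by apply: eq_bigr => i _; rewrite linearZ /= rowK mxvecK.
Qed.

(** * Products of column-stochastic matrices *)

Section Stochastic.
Variable R : realType.

(** In row-vector form, column sums pass through products by associativity. *)
Lemma col_stochastic_sumE m n (M : 'M[R]_(m, n)) :
  (const_mx 1 : 'rV_m) *m M = const_mx 1 <-> forall j, \sum_i M i j = 1.
Proof.
have E j : ((const_mx 1 : 'rV_m) *m M) 0 j = \sum_i M i j.
  by rewrite mxE; apply: eq_bigr => i _; rewrite mxE mul1r.
split=> [/matrixP M1 j | M1]; first by rewrite -E M1 mxE.
by apply/rowP => j; rewrite E M1 mxE.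
Qed.

Lemma col_stochastic_mul m n k (M : 'M[R]_(m, n)) (N : 'M[R]_(n, k)) :
  col_stochastic M -> col_stochastic N -> col_stochastic (M *m N).
Proof.
move=> [M0 /col_stochastic_sumE M1] [N0 /col_stochastic_sumE N1]; split.
  by move=> i j; rewrite mxE sumr_ge0 // => l _; rewrite mulr_ge0.
by apply/col_stochastic_sumE; rewrite mulmxA M1.
Qed.

Lemma col_stochastic_exp n (M : 'M[R]_n) t :
  col_stochastic M -> col_stochastic (M ^+ t).
Proof.
move=> M_st; elim: t => [|t IHt]; last by rewrite exprS; apply: col_stochastic_mul.
by split=> [i j|]; [rewrite mxE | apply/col_stochastic_sumE; rewrite mulmx1].
Qed.

Lemma prob_vecP k (x : 'cV[R]_k) : prob_vec x <-> col_stochastic x.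
Proof.
split=> -[x0 x1]; split=> //; first by move=> i j; rewrite ord1.
by move=> j; rewrite ord1.
Qed.

End Stochastic.

(** * The factors J and R of the conditional expectation *)

Section CanonicalBasis.
Variables (R : realType) (n : nat) (p : 'cV[R]_n) (A : {vspace 'cV[R]_n}).
Hypothesis p_gt0 : forall i, 0 < p i 0.
Implicit Types a b : (\dim A).-tuple 'cV[R]_n.

Lemma R_mxE d (a : d.-tuple 'cV[R]_n) j i : R_mx a j i = tnth a j i 0.
Proof.
rewrite summxE (bigD1 j) //= big1 => [|k kj].
  by rewrite mxE big_ord1 !mxE !eqxx mul1r addr0.
by rewrite mxE big_ord1 !mxE eq_sym (negPf kj) mul0r.
Qed.

Lemma J_mxE d (a : d.-tuple 'cV[R]_n) i j :
  J_mx p a i j = (inner p (tnth a j))^-1 * (p i 0 * tnth a j i 0).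
Proof.
rewrite summxE (bigD1 j) //= big1 => [|k kj].
  by rewrite !mxE big_ord1 !mxE !eqxx mulr1 addr0.
by rewrite !mxE big_ord1 !mxE [j == k]eq_sym (negPf kj) andbF !mulr0.
Qed.

Lemma cond_exp_mxE d (a : d.-tuple 'cV[R]_n) :
  cond_exp_mx p a = J_mx p a *m R_mx a.
Proof.
apply/matrixP => i j; rewrite mxE summxE; apply: eq_bigr => k _.
by rewrite J_mxE R_mxE !mxE big_ord1 !mxE mulrA.
Qed.

Lemma canonical_basis_ge0 a j i : canonical_basis a -> 0 <= tnth a j i 0.
Proof. by case=> _ /(_ j i)[] ->. Qed.

Lemma canonical_basis_mul a j k i : canonical_basis a ->
  tnth a j i 0 * tnth a k i 0 = (j == k)%:R * tnth a j i 0.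
Proof.
case=> _ a01 adisj; have [<-|jk] := eqVneq j k.
  by case: (a01 j i) => ->; rewrite ?mulr0 ?mulr1.
by move/colP/(_ i): (adisj j k jk); rewrite !mxE mul0r.
Qed.

(** As p is positive, zero mass would force a_j = 0, which freeness excludes. *)
Lemma canonical_basis_mass_gt0 a j :
  canonical_basis a -> 0 < inner p (tnth a j).
Proof.
move=> ca; have [ba _ _] := ca.
have term_ge0 i : 0 <= p i 0 * tnth a j i 0.
  by rewrite mulr_ge0 ?(ltW (p_gt0 i)) ?canonical_basis_ge0.
rewrite lt_def sumr_ge0 // andbT; apply/negP => /eqP sum0.
have : tnth a j = 0.
  apply/colP => i; rewrite [RHS]mxE; apply/eqP.
  have /eqP := psumr_eq0P (fun k _ => term_ge0 k) sum0 (i := i) isT.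
  by rewrite mulf_eq0 gt_eqF.
move/eqP; apply/negP; apply: (free_not0 (basis_free ba)); exact: mem_tnth.
Qed.

Lemma mem_canonical_basis a x : canonical_basis a -> x \in A ->
  exists c : 'cV_(\dim A), x = (R_mx a)^T *m c.
Proof.
move=> [ba _ _] xA; exists (\col_j coord a j x).
rewrite {1}(coord_basis ba xA); apply/colP => i; rewrite summxE mxE.
by apply: eq_bigr => j _; rewrite !mxE R_mxE (tnth_nth 0) mulrC.
Qed.

Lemma canonical_basis_mem a (c : 'cV_(\dim A)) :
  canonical_basis a -> (R_mx a)^T *m c \in A.
Proof.
move=> [ba _ _].
have -> : (R_mx a)^T *m c = \sum_j c j 0 *: tnth a j.
  apply/colP => i; rewrite summxE mxE.
  by apply: eq_bigr => j _; rewrite !mxE R_mxE mulrC.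
by apply: memv_suml => j _; rewrite memvZ // (basis_mem ba) ?mem_tnth.
Qed.

(** Entry (j, k) is the p-mass of the product of a_j and a_k over the p-mass of a_k, and distinct
    supports are disjoint. *)
Lemma R_mx_J_mx a : canonical_basis a -> R_mx a *m J_mx p a = 1%:M.
Proof.
move=> ca; apply/matrixP => j k; rewrite !mxE.
under eq_bigr do rewrite R_mxE J_mxE mulrCA [tnth a j _ 0 * _]mulrCA
  canonical_basis_mul //.
rewrite -mulr_sumr; have [<-|_] := eqVneq j k; last first.
  by rewrite big1 ?mulr0 // => i _; rewrite mul0r mulr0.
under eq_bigr do rewrite mul1r.
by rewrite mulVf // gt_eqF // canonical_basis_mass_gt0.
Qed.

Lemma col_stochastic_J_mx a : canonical_basis a -> col_stochastic (J_mx p a).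
Proof.
move=> ca; split=> [i j | j].
  rewrite J_mxE mulr_ge0 ?invr_ge0 ?(ltW (canonical_basis_mass_gt0 _ ca)) //.
  by rewrite mulr_ge0 ?(ltW (p_gt0 i)) // canonical_basis_ge0.
under eq_bigr do rewrite J_mxE.
by rewrite -mulr_sumr mulVf // gt_eqF // canonical_basis_mass_gt0.
Qed.

(** Dividing column j of J entrywise by p leaves a multiple of a_j. *)
Lemma J_mx_scaled a (c : 'cV_(\dim A)) : canonical_basis a ->
  hmul (hinv p) (J_mx p a *m c) \in A.
Proof.
move=> ca.
suff -> : hmul (hinv p) (J_mx p a *m c) =
    (R_mx a)^T *m (\col_j ((inner p (tnth a j))^-1 * c j 0)).
  exact: canonical_basis_mem.
apply/colP => i; rewrite !mxE mulr_sumr; apply: eq_bigr => j _.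
rewrite J_mxE !mxE R_mxE [_^-1 * (p i 0 * _)]mulrCA !mulrA mulVf ?gt_eqF //.
by rewrite mul1r [_^-1 * _]mulrC.
Qed.

(** Such an x lies in the range of J, where J R acts as the identity because R J = 1. *)
Lemma cond_exp_mx_id a x : canonical_basis a -> hmul (hinv p) x \in A ->
  cond_exp_mx p a *m x = x.
Proof.
move=> ca /(mem_canonical_basis ca)[c xc].
(* The factors [inner p (tnth a j)] undo the normalisation of the columns of J. *)
suff -> : x = J_mx p a *m (\col_j (inner p (tnth a j) * c j 0)).
  by rewrite cond_exp_mxE -mulmxA [R_mx a *m _]mulmxA R_mx_J_mx // mul1mx.
apply/colP => i; move/colP/(_ i): xc; rewrite !mxE => xc.
have -> : x i 0 = p i 0 * ((p i 0)^-1 * x i 0) by rewrite mulVKf ?gt_eqF.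
rewrite xc mulr_sumr; apply: eq_bigr => j _.
rewrite J_mxE !mxE R_mxE mulrACA mulVf ?mul1r ?mulrA //.
by rewrite gt_eqF // canonical_basis_mass_gt0.
Qed.

(* The product of the two conditional expectations equals each of them. *)
Lemma cond_exp_mx_unique a b : canonical_basis a -> canonical_basis b ->
  cond_exp_mx p a = cond_exp_mx p b.
Proof.
move=> ca cb; transitivity (cond_exp_mx p a *m cond_exp_mx p b).
  rewrite !cond_exp_mxE -mulmxA; congr (_ *m _).
  (* The rows of [R_mx b] span A, so [R_mx a] factors through it and absorbs
     [J_mx p b *m R_mx b]. *)
  suff [c ->] : exists c, R_mx a = c *m R_mx b.
    by rewrite -!mulmxA [R_mx b *m _]mulmxA R_mx_J_mx // mul1mx.
  have mem_a j : exists c, tnth a j = (R_mx b)^T *m c.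
    apply: mem_canonical_basis => //.
    by case: ca => ba _ _; rewrite (basis_mem ba) ?mem_tnth.
  have [c cP] := fin_all_exists mem_a.
  exists (\matrix_(j, k) c j k 0); apply/matrixP => j i.
  rewrite R_mxE cP !mxE; apply: eq_bigr => k _.
  by rewrite !mxE mulrC.
(* The columns of [J_mx p b], divided by p, lie in A, so the expectation along [a] fixes them. *)
rewrite [cond_exp_mx p b]cond_exp_mxE mulmxA; congr (_ *m _).
apply/matrixP => i k.
have := cond_exp_mx_id ca (J_mx_scaled (delta_mx k 0) cb).
rewrite mulmxA -!colE => /colP/(_ i).
by rewrite ![col _ _ _ _]mxE.
Qed.

End CanonicalBasis.

(** * Supports of subalgebras *)

Section Supports.
Variables (R : realType) (n : nat).
Implicit Types (x p : 'cV[R]_n) (U A : {vspace 'cV[R]_n}).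

Definition vanishing (i : 'I_n) : {vspace 'cV[R]_n} :=
  lker (linfun (@row R n 1 i)).

Lemma mem_vanishing i x : (x \in vanishing i) = (x i 0 == 0).
Proof.
rewrite memv_ker lfunE /=; apply/eqP/eqP => [/rowP/(_ 0)|xi].
  by rewrite !mxE.
by apply/rowP => j; rewrite !mxE ord1.
Qed.

(** [vanishing i] is itself a subalgebra, stable under entrywise scaling, so minimality of [alg]
    applies. *)
Lemma alg_scaled_vanishing p U i :
  (U <= vanishing i)%VS -> (alg_scaled p U <= vanishing i)%VS.
Proof.
move=> Ui; apply: (algP _).2; split=> [x y | _ [x /= xU <-]].
  by rewrite !mem_vanishing mxE => /eqP-> _; rewrite mul0r.
have := subvP Ui _ xU; rewrite /= !mem_vanishing !mxE => /eqP->.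
by rewrite mulr0.
Qed.

Lemma mem_alg_scaled p U x : x \in U -> hmul (hinv p) x \in alg_scaled p U.
Proof. by move=> xU; apply: (algP _).1.2; exists x. Qed.

(** Disjointness leaves at most one basis vector nonzero at i, which makes chi the indicator of the
    support of A. *)
Lemma canonical_basis_support A (a : (\dim A).-tuple 'cV[R]_n) i :
  canonical_basis a ->
  let chi := (const_mx 1 : 'rV_(\dim A)) *m R_mx a in
  (chi 0 i = 0 /\ forall j, tnth a j i 0 = 0) \/ chi 0 i = 1.
Proof.
move=> ca chi; have [_ a01 _] := ca.
have chiE : chi 0 i = \sum_j tnth a j i 0.
  by rewrite mxE; apply: eq_bigr => j _; rewrite mxE mul1r R_mxE.
have [/existsP[j aj]|/existsPn a0] := boolP [exists j, tnth a j i 0 != 0].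
  right; have aj1 : tnth a j i 0 = 1 by case: (a01 j i) aj => // ->; rewrite eqxx.
  rewrite chiE (bigD1 j) //= big1 ?addr0 // => k kj.
  have := canonical_basis_mul j k i ca.
  by rewrite aj1 mul1r eq_sym (negPf kj) mul0r.
have {}a0 j : tnth a j i 0 = 0 by apply/eqP; rewrite -[_ == _]negbK a0.
by left; split=> //; rewrite chiE big1.
Qed.

End Supports.

(** * Reachable and unobservable subspaces *)

Section Reduction.
Variables (R : realType) (m n : nat) (P : 'M[R]_n) (C : 'M[R]_(m, n)).
Variable S : set 'cV[R]_n.
Local Notation Z := (reach_unobs P C S).

Lemma mem_reach t p0 : S p0 -> P ^+ t *m p0 \in reach P S.
Proof. by move=> Sp0; apply: (vspanP _).1; exists t, p0. Qed.

Lemma reach_sub (U : {vspace 'cV[R]_n}) :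
  (forall t p0, S p0 -> P ^+ t *m p0 \in U) -> (reach P S <= U)%VS.
Proof. by move=> PU; apply: (vspanP _).2 => _ [t [p0 [Sp0 ->]]]; apply: PU. Qed.

Lemma reach_mul x : x \in reach P S -> P *m x \in reach P S.
Proof.
have stab : (reach P S <= linfun (mulmx P) @^-1: reach P S)%VS.
  apply: reach_sub => t p0 Sp0; rewrite -memv_preim lfunE /= mulmxA.
  by rewrite -/(P * P ^+ t) -exprS mem_reach.
by move=> xR; have := subvP stab x xR; rewrite -memv_preim lfunE.
Qed.

Lemma unobs_exp t x : x \in unobs P C -> C *m P ^+ t *m x = 0.
Proof.
move=> /mem_unobs xN; have [c ->] := expmx_sum_lt P t.
rewrite mulmx_sumr mulmx_suml big1 // => i _.
by rewrite -scalemxAr -scalemxAl xN ?scaler0.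
Qed.

Lemma reach_unobs_mul x : x \in Z -> P *m x \in Z.
Proof.
rewrite !memv_cap => /andP[xR xN]; rewrite reach_mul //=.
apply/mem_unobs => t _; rewrite mulmxA -[C *m _ *m P]mulmxA.
(* The exponent [t.+1] may equal n, beyond the range defining [unobs]. *)
by rewrite -[_ ^+ t *m P]/(P ^+ t * P) -exprSr unobs_exp.
Qed.

Lemma reach_unobs_out x : x \in Z -> C *m x = 0.
Proof. by rewrite memv_cap => /andP[_ /(@unobs_exp 0)]; rewrite mulmx1. Qed.

(** C preserves total mass, so the entries of x sum to those of C x = 0. *)
Lemma reach_unobs_sum x : col_stochastic C -> x \in Z ->
  (const_mx 1 : 'rV_n) *m x = 0.
Proof.
by case=> _ /col_stochastic_sumE <- /reach_unobs_out Cx; rewrite -mulmxA Cx mulmx0.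
Qed.

Lemma reduced_algP (E : {vspace 'cV[R]_n}) (p : 'cV[R]_n) :
    (forall i, 0 < p i 0) -> (Z + E)%VS = reach P S ->
  let A := reduced_alg P C S E p in
  (forall a : (\dim A).-tuple 'cV[R]_n, canonical_basis a ->
     forall x, x \in reach P S -> cond_exp_mx p a *m x - x \in Z) /\
  (forall i, (reach P S <= vanishing R i)%VS -> (A <= vanishing R i)%VS).
Proof.
move=> p_gt0 ZE; rewrite /reduced_alg; case: ifP => [stab | _]; split.
(* Split x = z + e: the expectation fixes e, so the difference is that of z alone, which the branch
   condition keeps in Z. *)
- move=> a ca x; rewrite -ZE => /memv_addP[z zZ [e eE ->]].
  rewrite mulmxDr [cond_exp_mx _ _ *m e]cond_exp_mx_id ?mem_alg_scaled //.
  rewrite [- (z + e)]opprD addrACA subrr addr0 rpredB //.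
  (* The branch condition concerns the chosen canonical basis; uniqueness carries it over to [a]. *)
  have cb : canonical_basis (some_canonical_basis (alg_scaled p E)).
    by apply: xgetPex; apply: canonical_basis_exists; apply: (algP _).1.1.
  rewrite (cond_exp_mx_unique p_gt0 ca cb).
  apply: (subvP stab); apply/memv_imgP; exists z => //.
  by rewrite lfunE.
- move=> i Ri; apply: alg_scaled_vanishing; apply: subv_trans Ri.
  by rewrite -ZE addvSr.
- move=> a ca x xR; rewrite cond_exp_mx_id ?mem_alg_scaled //.
  by rewrite subrr mem0v.
- by move=> i; apply: alg_scaled_vanishing.
Qed.

End Reduction.

Theorem theorem1 (R : realType) (m n : nat)
    (P : 'M[R]_n) (C : 'M[R]_(m, n)) (hPC : is_HMM P C)
    (S : set 'cV[R]_n) (finS : finite_set S)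
    (probS : forall p0, S p0 -> prob_vec p0)
    (E : {vspace 'cV[R]_n})
    (hE : directv (reach_unobs P C S + E)%VS /\
          (reach_unobs P C S + E)%VS = reach P S)
    (p : 'cV[R]_n) (hp : forall i, 0 < p i 0) :
  let A := reduced_alg P C S E p in
  let d := \dim A in
  (d <= n)%N /\
  forall a : d.-tuple 'cV[R]_n, canonical_basis a ->
    let J : 'M[R]_(n, d) := J_mx p a in
    let Rm : 'M[R]_(d, n) := R_mx a in
    let Pc : 'M[R]_d := Rm *m P *m J in
    let Cc : 'M[R]_(m, d) := C *m J in
    (is_HMM Pc Cc /\ forall p0, S p0 -> prob_vec (Rm *m p0)) /\
    (forall (t : nat) p0, S p0 ->
       C *m P ^+ t *m p0 = Cc *m Pc ^+ t *m (Rm *m p0)).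
Proof.
move=> A d; split.
  by apply: leq_trans (dimvS (subvf A)) _; rewrite dimvf dim_matrix mulr1.
move=> a ca J Rm Pc Cc.
have [P_st C_st] := hPC; have [_ ZE] := hE.
have [/(_ a ca) fixA suppA] := reduced_algP hp ZE.
have J_st : col_stochastic J by apply: col_stochastic_J_mx.
have Rm_ge0 j i : 0 <= Rm j i by rewrite R_mxE canonical_basis_ge0.
pose x t (p0 : 'cV[R]_n) := P ^+ t *m p0.
have x_st t p0 : S p0 -> col_stochastic (x t p0).
  move=> Sp0; apply: col_stochastic_mul; first exact: col_stochastic_exp.
  by apply/prob_vecP/probS.
pose chi := (const_mx 1 : 'rV_d) *m Rm.
have chi_reach y : y \in reach P S -> chi *m y = (const_mx 1 : 'rV_n) *m y.
  move=> yR; have := reach_unobs_sum C_st (fixA y yR).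
  rewrite cond_exp_mxE mulmxBr => /eqP; rewrite subr_eq0 => /eqP <-.
  by rewrite !mulmxA (col_stochastic_sumE J).2 //; case: J_st.
have x_off t p0 i : S p0 -> chi 0 i = 0 -> x t p0 i 0 = 0.
  move=> Sp0 chi0; have /rowP/(_ 0) := chi_reach _ (mem_reach P t Sp0).
  (* The terms (1 - chi_k) x_k are nonnegative with sum zero, so each vanishes. *)
  rewrite [LHS]mxE [RHS]mxE => /eqP; rewrite eq_sym -subr_eq0 -sumrB => /eqP sum0.
  have [x0 _] := x_st t _ Sp0.
  have := psumr_eq0P _ sum0 (i := i); rewrite chi0 mxE mul1r mul0r subr0.
  apply=> // k _; rewrite mxE -mulrBl mulr_ge0 ?x0 // subr_ge0.
  by have [[-> _]|->] := canonical_basis_support k ca; rewrite ?ler01.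
(* If P l i were nonzero, then (P x)_l = 0, a sum of nonnegative terms, would force x_i = 0 on all
   of [reach], hence on A. *)
have P_off i l : chi 0 i = 1 -> chi 0 l = 0 -> P l i = 0.
  move=> chi1 chi0; apply: contrapT => Pli.
  have : (A <= vanishing R i)%VS.
    apply: suppA; apply: reach_sub => t p0 Sp0; rewrite mem_vanishing.
    have := x_off t.+1 p0 l Sp0 chi0.
    rewrite /x exprS -mulmxA mxE => /psumr_eq0P/(_ i isT)/eqP.
    rewrite mulf_eq0 => H; have [||//] := orP (H _).
      move=> k _; rewrite mulr_ge0 //; first by case: P_st.
      by case: (x_st t p0 Sp0).
    by move/eqP/Pli.
  move=> Ai; move: chi1; rewrite mxE big1 => [/esym/eqP|j _].
    by rewrite oner_eq0.
  have /(subvP Ai) : tnth a j \in A.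
    by case: ca => ba _ _; rewrite (basis_mem ba) ?mem_tnth.
  by rewrite mem_vanishing R_mxE => /eqP->; rewrite mulr0.
split; first split.
- split; last exact: col_stochastic_mul.
  have PJ_st := col_stochastic_mul P_st J_st.
  split=> [j k|].
    rewrite /Pc -mulmxA mxE sumr_ge0 // => i _; rewrite mulr_ge0 //.
    by case: PJ_st.
  apply/col_stochastic_sumE; rewrite /Pc !mulmxA -/chi -mulmxA.
  have <- : (const_mx 1 : 'rV_n) *m (P *m J) = const_mx 1.
    by apply/col_stochastic_sumE; case: PJ_st.
  (* chi and the all-ones row differ only off the support, where the rows of P J vanish. *)
  apply/rowP => k; rewrite mxE [RHS]mxE; apply: eq_bigr => l _.
  have [[chi0 _]|->] := canonical_basis_support l ca; last by rewrite [const_mx _ _ _]mxE.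
  suff -> : (P *m J) l k = 0 by rewrite !mulr0.
  rewrite mxE big1 // => i _.
  have [[_ a0]|chi1] := canonical_basis_support i ca.
    by rewrite J_mxE a0 !mulr0.
  by rewrite (P_off i l) ?mul0r.
- move=> p0 Sp0; have [p0_ge0 p0_sum] := probS _ Sp0.
  apply/prob_vecP; split=> [j k|].
    by rewrite mxE sumr_ge0 // => i _; rewrite ord1 mulr_ge0.
  apply/col_stochastic_sumE; rewrite mulmxA -/chi chi_reach.
    by apply/col_stochastic_sumE => j; rewrite ord1.
  by have := mem_reach P 0 Sp0; rewrite mul1mx.
move=> t p0 Sp0.
suff : J *m (Pc ^+ t *m (Rm *m p0)) - x t p0 \in reach_unobs P C S.
  move/reach_unobs_out; rewrite mulmxBr => /eqP; rewrite subr_eq0 => /eqP.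
  by rewrite /Cc !mulmxA => ->.
(* Z lies in [reach], so a vector congruent to a trajectory point is reachable and [fixA] applies to
   it. *)
have mem_diff y t' : y - x t' p0 \in reach_unobs P C S -> y \in reach P S.
  rewrite memv_cap => /andP[yx _].
  by rewrite -(subrK (x t' p0) y) rpredD // mem_reach.
(* Applying J R does not change the class modulo Z. *)
have stepJ y t' : y - x t' p0 \in reach_unobs P C S ->
    J *m (Rm *m y) - x t' p0 \in reach_unobs P C S.
  move=> yx; rewrite mulmxA -cond_exp_mxE -(subrKA y) rpredD //.
  by rewrite fixA // (mem_diff _ t').
elim: t => [|t IHt].
  rewrite mul1mx; apply: stepJ.
  by rewrite /x mul1mx subrr mem0v.
(* Regrouped this way, a reduced step is P followed by J R once J is applied; both respect
   congruence modulo Z. *)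
have -> : Pc ^+ t.+1 *m (Rm *m p0) =
    Rm *m (P *m (J *m (Pc ^+ t *m (Rm *m p0)))).
  by rewrite exprS !mulmxA.
apply: stepJ; rewrite /x exprS -mulmxA -mulmxBr.
exact: reach_unobs_mul.
Qed.
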